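(* Let $\{S_n, n\ge 1\}$ be a sequence of integer-valued random variables, and let $a_n\in\mathbb{R}$ and $b_n>0$ be real numbers with $b_n\to\infty$ such that the distributions of $(S_n-a_n)/b_n$ converge weakly to an absolutely continuous distribution with distribution function $G$ and density $g$, where $g$ is uniformly continuous on $\mathbb{R}$. Put $$\varepsilon_n:=\sup_{x\in\mathbb{R}}\Big|\mathbb{P}\Big\{\frac{S_n-a_n}{b_n}<x\Big\}-G(x)\Big|,$$ so that $\varepsilon_n\to 0$. Then the local limit theorem in the usual form, namely $$\mathbb{P}\{S_n=m\}=\frac{1}{b_n}\,g\Big(\frac{m-a_n}{b_n}\Big)+o\Big(\frac{1}{b_n}\Big)\quad\text{uniformly in } m\in\mathbb{Z},\qquad n\to\infty,$$ holds if and only if $$\sup_{\substack{m,k\in\mathbb{Z}\\ |m-k|\le \max\{1,[\sqrt{\varepsilon_n}\, b_n]\}}}\Big|\mathbb{P}\{S_n=m\}-\mathbb{P}\{S_n=k\}\Big| = o\Big(\frac{1}{b_n}\Big),\qquad n\to\infty.$$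
   Context: No independence or other structural assumption on the $S_n$ is made. $[x]$ denotes the integer part of the real number $x$; in $[\sqrt{\varepsilon_n}\, b_n]$ the square root applies to $\varepsilon_n$ only. *)

(* Defs.v *)
From HB Require Import structures.
From mathcomp Require Import all_boot all_order all_algebra.
From mathcomp Require Import all_classical all_reals all_analysis.
From mathcomp Require Import measurable_realfun.
Set Implicit Arguments.
Unset Strict Implicit.
Unset Printing Implicit Defensive.
Import Order.TTheory GRing.Theory Num.Theory.
Import numFieldNormedType.Exports.
Local Open Scope classical_set_scope.
Local Open Scope ring_scope.

Definition normalized {d : measure_display} {T : measurableType d}
    {R : realType} (X : T -> R) (a b : R) : T -> R :=
  fun w => (X w - a) / b.

Section normalized_mfun.
Context {d : measure_display} {T : measurableType d} {R : realType}.
Variables (X : {mfun T >-> R}) (a b : R).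

Let measurable_normalized : measurable_fun [set: T] (normalized X a b).
Proof.
apply: measurable_funM; last exact: measurable_cst.
by apply: measurable_funB => //; exact: measurable_cst.
Qed.

HB.instance Definition _ :=
  isMeasurableFun.Build _ _ _ _ (normalized X a b) measurable_normalized.

End normalized_mfun.

Definition converges_weakly {R : realType}
    (mu_ : nat -> probability R R)
    (mu : probability R R) : Prop :=
  forall f : R -> R, continuous f -> [bounded f x | x in [set: R]] ->
    (\int[mu_ n]_x (f x)%:E)%E @[n --> \oo] --> (\int[mu]_x (f x)%:E)%E.

Definition has_density {R : realType}
    (mu : probability R R) (g : R -> R) : Prop :=
  [/\ measurable_fun [set: R] g,
      forall x, 0 <= g x &
      forall A : set R, measurable A ->
        mu A = (\int[lebesgue_measure]_(x in A) (g x)%:E)%E].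

(* Left-continuous convention: the value at x is the mass of the open half-line
   ]-oo, x[, whereas the library's cdf uses ]-oo, x]. *)
Definition distr_fun {R : realType} (mu : probability R R)
    (x : R) : R :=
  fine (mu `]-oo, x[%classic).

(* The set below is nonempty and, when G takes values in [0, 1], bounded, so
   that sup is then a genuine supremum. *)
Definition kolmogorov_dist {d : measure_display} {T : measurableType d}
    {R : realType} (P : probability T R) (X : T -> R) (G : R -> R) : R :=
  sup [set `|fine (P [set w | X w < x]) - G x| | x in [set: R]].

(* f n i = o(u n) as n tends to infinity, uniformly in i. *)
Definition uniform_littleo {R : realType} {I : Type}
    (f : nat -> I -> R) (u : nat -> R) : Prop :=
  forall e : R, 0 < e ->
    \forall n \near \oo, forall i : I, `|f n i| <= e * `|u n|.

(* Largest difference of the point probabilities of X over pairs of integers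
   at distance at most h; the set is nonempty for 0 <= h and bounded by 1. *)
Definition pmf_oscillation {d : measure_display} {T : measurableType d}
    {R : realType} (P : probability T R) (X : {RV P >-> R}) (h : int) : R :=
  sup [set r | exists m k : int,
         `|m - k| <= h /\ r = `|pmf X m%:~R - pmf X k%:~R|].

(* Main.v *)
Require Import Defs.
From HB Require Import structures.
From mathcomp Require Import all_boot all_order all_algebra.
From mathcomp Require Import all_classical all_reals all_analysis.
From mathcomp Require Import measurable_realfun.
From mathcomp Require Import ring lra zify.
Set Implicit Arguments.
Unset Strict Implicit.
Unset Printing Implicit Defensive.
Import Order.TTheory GRing.Theory Num.Theory.
Import numFieldNormedType.Exports.
Local Open Scope classical_set_scope.
Local Open Scope ring_scope.

(** Point probabilities are compared with their averages over blocks of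
[h = max (1, [sqrt eps * b])] consecutive integers: such a block is short
compared with [b], yet long compared with [eps * b].

Weak convergence to a law with continuous distribution function is uniform
convergence of distribution functions (Polya, [polya_distr_fun_cvg]), so that
[eps n --> 0]; with [b n --> +oo] this gives [h / b --> 0]
([block_length_near]).

If the local limit theorem holds, then point probabilities at distance at most
[h] differ by [o(1/b)] plus [1/b] times the oscillation of [g] over a length
[h / b --> 0], which is [o(1)] because [g] is uniformly continuous.

Conversely, if the oscillation over blocks is [o(1/b)], then [P(S = m)] equals,
up to [o(1/b)], the average of the point probabilities over
[m, m + h - 1]. That average is [1/h] times an increment of the distribution
function of [S], hence [1/h] times an increment of [G] over an interval of
length [h / b], up to [2 * eps / h]. The increment of [G] is
[(h / b) * (g ((m - a) / b) + o(1))] by uniform continuity of [g], and the error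
[eps / h] is at most [2 * sqrt eps / b = o(1/b)], since [sqrt eps * b <= 2 * h]
by the choice of [h]. The inequality behind this argument is
[block_average_bound], in which every error is explicit. *)

(** * Uniform continuity on the real line *)

Lemma unif_continuousP (R : realType) (g : R -> R) :
  unif_continuous g <->
  forall e : R, 0 < e -> exists2 dl : R, 0 < dl &
    forall x y, `|x - y| < dl -> `|g x - g y| < e.
Proof.
split=> [g_unif e e_gt0|g_unif A].
  have := g_unif _ (entourage_ball R (PosNum e_gt0)).
  rewrite /= -{1}entourage_from_ballE => -[dl /= dl_gt0 sub].
  by exists dl => // x y xy; apply: (sub (x, y)).
rewrite -{1}entourage_from_ballE => -[e /= e_gt0 sub].
have [dl dl_gt0 g_dl] := g_unif e e_gt0.
rewrite /nbhs/= -entourage_from_ballE; exists dl => // -[x y] /= xy.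
by apply: sub; exact: g_dl.
Qed.

Lemma unif_continuous_continuous (R : realType) (g : R -> R) :
  unif_continuous g -> continuous g.
Proof.
move=> /unif_continuousP g_unif x; apply/cvgrPdist_lt => e /g_unif[dl dl_gt0 g_dl].
by apply/nbhs_ballP; exists dl => //= y; exact: g_dl.
Qed.

(** * Distribution functions of probabilities on the line *)

Section distr_fun_facts.
Context {R : realType} (mu : probability R R).
Implicit Types x y : R.

Lemma distr_fun_ge0 x : 0 <= distr_fun mu x.
Proof. exact: fine_ge0. Qed.

Lemma distr_funE x : (distr_fun mu x)%:E = mu `]-oo, x[%classic.
Proof. by rewrite fineK// fin_num_measure. Qed.

Lemma distr_fun_le1 x : distr_fun mu x <= 1.
Proof. by rewrite -lee_fin distr_funE probability_le1. Qed.

Lemma distr_funB x y : x <= y ->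
  (distr_fun mu y - distr_fun mu x)%:E = mu `[x, y[%classic.
Proof.
move=> xy; rewrite EFinB !distr_funE.
have -> : `]-oo, y[%classic = `]-oo, x[ `|` `[x, y[ :> set R.
  by apply: itv_bndbnd_setU; rewrite bnd_simp.
rewrite measureU//; last first.
  by apply/seteqP; split => // t /=; rewrite !in_itv/= => -[tx]; rewrite leNgt tx.
by rewrite addeAC subee ?add0e// fin_num_measure.
Qed.

Lemma le_distr_fun x y : x <= y -> distr_fun mu x <= distr_fun mu y.
Proof. by move=> xy; rewrite -subr_ge0 -lee_fin distr_funB. Qed.

(** The [cdf] of the identity variable at [x] is the mass of ]-oo, x], a set that
contains ]-oo, x[ and is contained in ]-oo, x + 1[; this transfers its limits at
infinity to [distr_fun]. *)
Lemma distr_fun_tails e : 0 < e ->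
  exists A, distr_fun mu (- A) <= e /\ 1 - e <= distr_fun mu A.
Proof.
move=> e_gt0.
have id_meas : @measurable_fun _ _ R R setT (@idfun R) := @measurable_id _ R setT.
pose X : {RV mu >-> R} := mfun_Sub (mem_set id_meas).
have cdf_fin x : cdf X x = (fine (mu `]-oo, x]%classic))%:E.
  by rewrite fineK// fin_num_measure.
have [A [_ leA]] : \forall x \near +oo, 1 - e <= fine (mu `]-oo, x]%classic).
  have /fine_cvg /cvgrPdist_le /(_ _ e_gt0) := @cvg_cdfy1 _ _ _ mu X.
  by apply: filterS => x /=; rewrite cdf_fin /= ler_norml => /andP[]; lra.
have [B [_ leB]] : \forall x \near -oo, fine (mu `]-oo, x]%classic) <= e.
  have /fine_cvg /cvgrPdist_le /(_ _ e_gt0) := @cvg_cdfNy0 _ _ _ mu X.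
  by apply: filterS => x /=; rewrite cdf_fin /= ler_norml => /andP[]; lra.
pose C := Num.max (A + 2) (- B + 1).
have CA : A + 2 <= C by rewrite le_max lexx.
have CB : - B + 1 <= C by rewrite le_max lexx orbT.
exists C; split.
  apply: le_trans (leB (- C) _); last by lra.
  rewrite fine_le ?fin_num_measure// le_measure ?inE//.
  by apply: subset_itvl; rewrite bnd_simp.
apply: le_trans (leA (C - 1) _) _; first by lra.
rewrite fine_le ?fin_num_measure// le_measure ?inE//.
by apply: subset_itvl; rewrite bnd_simp; lra.
Qed.
End distr_fun_facts.

(** * From weak convergence to uniform convergence of distribution functions *)

(** The continuous bounded test function equal to 1 up to [x], to 0 from [y] on,
and affine in between; it lies between the indicators of ]-oo, x[ and
]-oo, y[. *)
Definition ramp (R : realType) (x y t : R) : R :=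
  Num.max 0 (Num.min 1 ((y - t) / (y - x))).

Section ramp_facts.
Context {R : realType}.
Variables (x y : R).
Hypothesis xy : x < y.

Lemma ramp_ge0 t : 0 <= ramp x y t.
Proof. by rewrite le_max lexx. Qed.

Lemma ramp_le1 t : ramp x y t <= 1.
Proof. by rewrite ge_max ler01 ge_min lexx. Qed.

Lemma ramp_eq1 t : t <= x -> ramp x y t = 1.
Proof.
move=> tx; apply/le_anti; rewrite ramp_le1/= le_max le_min lexx/=.
by rewrite ler_pdivlMr ?subr_gt0// mul1r lerD2l lerN2 tx orbT.
Qed.

Lemma ramp_eq0 t : y <= t -> ramp x y t = 0.
Proof.
move=> yt; apply/le_anti; rewrite ramp_ge0 andbT ge_max lexx/= ge_min.
by rewrite ler_pdivrMr ?subr_gt0// mul0r subr_le0 yt orbT.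
Qed.

Lemma continuous_ramp : continuous (ramp x y).
Proof.
move=> t.
have -> : ramp x y =
  cst 0 \max (cst 1 \min (fun t => (y - t) / (y - x)) : R -> R^o) by [].
apply: continuous_max; first exact: cvg_cst.
apply: continuous_min; first exact: cvg_cst.
by apply: cvgM; [apply: cvgB; [exact: cvg_cst|exact: cvg_id]|exact: cvg_cst].
Qed.

Lemma bounded_ramp : [bounded ramp x y t | t in [set: R]].
Proof.
exists 1; split => // M /ltW M1 t _ /=.
by rewrite ger0_norm ?ramp_ge0//; exact: le_trans (ramp_le1 t) M1.
Qed.

Lemma integral_ramp_bounds (mu : probability R R) :
  exists2 r, (\int[mu]_t (ramp x y t)%:E)%E = r%:E &
    distr_fun mu x <= r <= distr_fun mu y.
Proof.
have meas : measurable_fun setT (fun t => (ramp x y t)%:E).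
  by apply/measurable_EFinP; exact: continuous_measurable_fun continuous_ramp.
have ind_int z : (\int[mu]_t (\1_`]-oo, z[%classic t)%:E)%E = (distr_fun mu z)%:E.
  by rewrite integral_indic// setIT distr_funE.
have ind_meas z : measurable_fun setT
    (fun t => (\1_(`]-oo, z[%classic : set R) t)%:E : \bar R).
  by apply/measurable_EFinP; exact: measurable_indic.
have lo : ((distr_fun mu x)%:E <= \int[mu]_t (ramp x y t)%:E)%E.
  rewrite -ind_int; apply: ge0_le_integral => [//|t _|//|//|t _].
    by rewrite lee_fin.
  rewrite lee_fin indicE mem_setE in_itv/=.
  case: ltP => tx; last exact: ramp_ge0.
  by rewrite ramp_eq1// ltW.
have hi : (\int[mu]_t (ramp x y t)%:E <= (distr_fun mu y)%:E)%E.
  rewrite -ind_int; apply: ge0_le_integral => [//|t _|//|//|t _].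
    by rewrite lee_fin ramp_ge0.
  rewrite lee_fin indicE mem_setE in_itv/=.
  case: ltP => ty; first exact: ramp_le1.
  by rewrite ramp_eq0.
have fin : (\int[mu]_t (ramp x y t)%:E)%E \is a fin_num.
  by rewrite fin_numElt (lt_le_trans _ lo) ?ltNyr// (le_lt_trans hi) ?ltry.
exists (fine (\int[mu]_t (ramp x y t)%:E)%E); first by rewrite fineK.
by apply/andP; split; rewrite -lee_fin (fineK fin).
Qed.
End ramp_facts.

(** Ramps just to the left and just to the right of [x] squeeze
[distr_fun (nu n) x] between integrals of continuous functions. *)
Lemma converges_weakly_distr_fun (R : realType) (nu : nat -> probability R R)
    (mu : probability R R) (x : R) :
  converges_weakly nu mu -> {for x, continuous (distr_fun mu)} ->
  distr_fun (nu n) x @[n --> \oo] --> distr_fun mu x.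
Proof.
move=> nu_cvg mu_cont; apply/cvgrPdist_le => e e_gt0.
have e2_gt0 : 0 < e / 2 by rewrite divr_gt0.
have [dl /= dl_gt0 near_x] : exists2 dl, 0 < dl &
    forall y, `|x - y| <= dl -> `|distr_fun mu x - distr_fun mu y| <= e / 2.
  have /cvgrPdist_le /(_ _ e2_gt0) /nbhs_ballP [r /= r_gt0 ball_r] := mu_cont.
  exists (r / 2); first by rewrite divr_gt0.
  by move=> y xy; apply: ball_r; apply: le_lt_trans xy _; lra.
have ramp_cvg y z : y < z -> exists2 r, distr_fun mu y <= r <= distr_fun mu z &
    \forall n \near \oo, distr_fun (nu n) y <= r + e / 2 /\
                         r - e / 2 <= distr_fun (nu n) z.
  move=> yz; have [r mu_r r_bnd] := integral_ramp_bounds yz mu; exists r => //.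
  have := nu_cvg _ (@continuous_ramp R y z) (@bounded_ramp R y z).
  rewrite mu_r => /fine_cvg /cvgrPdist_le /(_ _ e2_gt0); apply: filterS => n /=.
  have [s -> /=] := integral_ramp_bounds yz (nu n).
  by rewrite ler_norml; lra.
have [r r_bnd near_r] := ramp_cvg (x - dl) x ltac:(lra).
have [s s_bnd near_s] := ramp_cvg x (x + dl) ltac:(lra).
have := near_x (x - dl); have := near_x (x + dl).
rewrite !ler_norml => mur mul.
apply: filterS2 near_r near_s => n nu_l nu_r.
rewrite ler_norml; lra.
Qed.

(** Polya's theorem: by monotonicity, closeness at the points of a finite grid
propagates to all points, provided that the limit varies little between
neighbouring grid points and beyond the two ends of the grid. *)
Lemma polya_distr_fun_cvg (R : realType) (nu : nat -> probability R R)
    (mu : probability R R) :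
  (forall x, distr_fun (nu n) x @[n --> \oo] --> distr_fun mu x) ->
  unif_continuous (distr_fun mu) ->
  forall e : R, 0 < e -> \forall n \near \oo,
    forall x, `|distr_fun (nu n) x - distr_fun mu x| <= e.
Proof.
move=> nu_cvg /unif_continuousP G_unif e e_gt0.
have e2_gt0 : 0 < e / 2 by rewrite divr_gt0.
have [dl dl_gt0 G_dl] := G_unif _ e2_gt0.
have [A [G_Nle G_Nge]] := distr_fun_tails mu e2_gt0.
(* Half the modulus, so that two neighbouring grid points satisfy the strict
   inequality in the property of [dl]. *)
pose st := dl / 2.
have [st_gt0 st_lt] : 0 < st /\ st < dl by rewrite /st; split; lra.
pose p i := - A + i%:R * st : R.
have pS i : p i.+1 = p i + st by rewrite /p -natr1; ring.
have [K leK] : exists K : nat, A <= p K.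
  exists (Num.truncn ((A + A) / st)).+1.
  have := truncnS_gt ((A + A) / st).
  by rewrite ltr_pdivrMr// /p; lra.
have G_step i x : p i <= x < p i.+1 ->
    distr_fun mu (p i.+1) - e / 2 <= distr_fun mu x <= distr_fun mu (p i) + e / 2.
  rewrite pS => /andP[pix xpi].
  have /G_dl : `|p i + st - x| < dl by rewrite ltr_norml; apply/andP; split; lra.
  have /G_dl : `|p i - x| < dl by rewrite ltr_norml; apply/andP; split; lra.
  by rewrite !ltr_norml => /andP[? ?] /andP[? ?]; apply/andP; split; lra.
have near_p (i : 'I_K.+1) : \forall n \near \oo,
    `|distr_fun mu (p i) - distr_fun (nu n) (p i)| <= e / 2.
  by have /cvgrPdist_le := nu_cvg (p i); exact.
apply: filterS (filter_forall _ near_p) => n {}near_p x.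
have nu_p i : (i <= K)%N ->
    `|distr_fun mu (p i) - distr_fun (nu n) (p i)| <= e / 2.
  by move=> iK; exact: (near_p (Ordinal (iK : (i < K.+1)%N))).
have p0 : p 0%N = - A by rewrite /p mul0r addr0.
rewrite -p0 in G_Nle.
rewrite ler_norml; have [x_lt|x_ge] := ltP x (p 0%N).
  have := le_distr_fun (nu n) (ltW x_lt); have := le_distr_fun mu (ltW x_lt).
  have := distr_fun_ge0 (nu n) x; have := distr_fun_ge0 mu x.
  have := nu_p 0%N isT; rewrite ler_norml => /andP[? ?].
  by move=> *; apply/andP; split; lra.
have [x_ge_K|x_lt_K] := leP (p K) x.
  have := le_distr_fun (nu n) x_ge_K; have := le_distr_fun mu x_ge_K.
  have := distr_fun_le1 (nu n) x; have := distr_fun_le1 mu x.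
  have := le_distr_fun mu leK.
  have := nu_p K (leqnn K); rewrite ler_norml => /andP[? ?] *.
  by apply/andP; split; lra.
have [i iK /[dup] /andP[pix xpi] /G_step /andP[G_le G_ge]] :
    exists2 i, (i < K)%N & p i <= x < p i.+1.
  elim: K x_lt_K {leK near_p nu_p} => [|k IHk]; first by rewrite ltNge x_ge.
  have [x_lt_k _|x_ge_k x_lt] := ltP x (p k).
    by have [i ik px] := IHk x_lt_k; exists i => //; exact: ltnW.
  by exists k; rewrite // x_ge_k.
have := nu_p i (ltnW iK); have := nu_p i.+1 iK.
rewrite !ler_norml => /andP[? ?] /andP[? ?].
have := le_distr_fun (nu n) pix; have := le_distr_fun (nu n) (ltW xpi).
by move=> ? ?; apply/andP; split; lra.
Qed.

(** * Consequences of a uniformly continuous density *)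

Section density.
Context {R : realType} (mu : probability R R) (g : R -> R).
Hypothesis g_mu : has_density mu g.

Lemma distr_fun_increment_bounds (x y lo hi : R) : x <= y ->
  (forall t, x <= t < y -> lo <= g t <= hi) ->
  lo * (y - x) <= distr_fun mu y - distr_fun mu x <= hi * (y - x).
Proof.
rewrite le_eqVlt => /predU1P[-> _|xy g_bnd]; first by rewrite !subrr !mulr0 lexx.
have [g_meas g_ge0 g_int] := g_mu.
have gE_meas : measurable_fun (`[x, y[%classic : set R) (EFin \o g).
  by apply/measurable_EFinP; exact: measurable_funTS.
have cst_int c : (\int[lebesgue_measure]_(t in `[x, y[%classic) (cst c%:E t))%E
    = (c * (y - x))%:E.
  rewrite integral_cst//=.
  by rewrite lebesgue_measure_itv/= lte_fin xy EFinM.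
apply/andP; split; last first.
  rewrite -lee_fin distr_funB ?(ltW xy)// g_int// -cst_int.
  apply: ge0_le_integral => // t; rewrite /= in_itv/= lee_fin => t_xy//.
  by have /andP[] := g_bnd t t_xy.
(* The comparison of integrals is between nonnegative functions; a nonpositive
   [lo] is handled by monotonicity alone. *)
have [lo_le0|lo_gt0] := leP lo 0.
  apply: le_trans (_ : 0 <= _); first by rewrite mulr_le0_ge0// subr_ge0 ltW.
  by rewrite subr_ge0 le_distr_fun// ltW.
rewrite -lee_fin distr_funB ?(ltW xy)// g_int// -cst_int.
apply: ge0_le_integral => // t; rewrite /= ?lee_fin ?(ltW lo_gt0)// in_itv/= => t_xy.
by have /andP[] := g_bnd t t_xy.
Qed.

Hypothesis g_unif : unif_continuous g.

(** A large value of [g] at [x] would persist over the length [dl] of its modulus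
of continuity, and the mass of [x, x + dl[ would exceed 1. *)
Lemma density_bounded : exists2 M, 0 < M & forall x, g x <= M.
Proof.
have [dl dl_gt0 g_dl] := (unif_continuousP g).1 g_unif 1 ltr01.
exists (1 + dl^-1) => [|x]; first by rewrite addr_gt0 ?invr_gt0.
have x_le : x <= x + dl by lra.
have /(_ _)/andP[|+ _] :=
  @distr_fun_increment_bounds x (x + dl) (g x - 1) (g x + 1) x_le.
  move=> t /andP[xt tx]; have /g_dl : `|x - t| < dl.
    by rewrite ltr_norml; apply/andP; split; lra.
  by rewrite ltr_norml => /andP[? ?]; apply/andP; split; lra.
have := distr_fun_le1 mu (x + dl); have := distr_fun_ge0 mu x.
rewrite (_ : x + dl - x = dl); last by ring.
move=> G0 G1 G_ge; rewrite -lerBlDl -[dl^-1]mul1r ler_pdivlMr//; lra.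
Qed.

(** The distribution function is Lipschitz, with an upper bound of [g] as
constant. *)
Lemma distr_fun_unif_continuous : unif_continuous (distr_fun mu).
Proof.
have [M M_gt0 g_le] := density_bounded; have [_ g_ge0 _] := g_mu.
apply/unif_continuousP => e e_gt0; exists (e / M); first exact: divr_gt0.
move=> x y; wlog xy : x y / x <= y => [IH|].
  have [/IH//|/ltW/IH {}IH] := leP x y.
  by rewrite distrC => /IH; rewrite distrC.
rewrite ltr_pdivlMr// [`|x - y|]distrC ger0_norm ?subr_ge0// distrC.
rewrite ger0_norm ?subr_ge0 ?le_distr_fun//; apply: le_lt_trans.
have /andP[_] := distr_fun_increment_bounds xy
  (fun t _ => introT andP (conj (g_ge0 t) (g_le t))).
by rewrite mulrC.
Qed.

End density.

(** * Kolmogorov distance, oscillation and sums of point probabilities *)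

Lemma dist_itv01_le1 (R : realDomainType) (u v : R) :
  0 <= u <= 1 -> 0 <= v <= 1 -> `|u - v| <= 1.
Proof. by rewrite ler_norml => /andP[? ?] /andP[? ?]; apply/andP; split; lra. Qed.

Section kolmogorov.
Context {d : measure_display} {T : measurableType d} {R : realType}.
Context (P : probability T R).
Implicit Types (X : {RV P >-> R}) (G : R -> R).

Lemma fine_prob_lt X x :
  fine (P [set w | X w < x]) = distr_fun (distribution P X) x.
Proof.
by rewrite /distr_fun /distribution /pushforward; congr (fine (P _)).
Qed.

Lemma le_kolmogorov_dist X G x : (forall y, 0 <= G y <= 1) ->
  `|distr_fun (distribution P X) x - G x| <= kolmogorov_dist P X G.
Proof.
move=> G01; apply: ub_le_sup; last by exists x => //; rewrite fine_prob_lt.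
exists 1 => _ [y _ <-]; rewrite fine_prob_lt.
by apply: dist_itv01_le1 => //; rewrite distr_fun_ge0 distr_fun_le1.
Qed.

Lemma kolmogorov_dist_le X G e :
  (forall x, `|distr_fun (distribution P X) x - G x| <= e) ->
  kolmogorov_dist P X G <= e.
Proof.
move=> F_G; apply: ge_sup => [|_ [x _ <-]].
  by exists `|fine (P [set w | X w < 0]) - G 0|; exists 0.
by rewrite fine_prob_lt.
Qed.

Lemma pmfE X x : (pmf X x)%:E = P (X @^-1` [set x]).
Proof.
have meas : measurable (X @^-1` [set x]) by exact: measurable_funPTI.
by rewrite fineK// fin_num_measure.
Qed.

Lemma pmf_le1 X x : pmf X x <= 1.
Proof. by rewrite -lee_fin pmfE probability_le1//; exact: measurable_funPTI. Qed.

Lemma le_pmf_oscillation X (h m k : int) : `|m - k| <= h ->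
  `|pmf X m%:~R - pmf X k%:~R| <= pmf_oscillation X h.
Proof.
move=> mk; apply: ub_le_sup; last by exists m, k.
exists 1 => _ [i [j [_ ->]]].
by apply: dist_itv01_le1; rewrite pmf_ge0 pmf_le1.
Qed.

Lemma pmf_oscillation_le X (h : int) e : 0 <= h ->
  (forall m k : int, `|m - k| <= h -> `|pmf X m%:~R - pmf X k%:~R| <= e) ->
  pmf_oscillation X h <= e.
Proof.
move=> h0 le_e; apply: ge_sup => [|_ [m [k [mk ->]]]]; last exact: le_e.
by exists `|pmf X 0%:~R - pmf X 0%:~R|, 0, 0; rewrite subrr normr0.
Qed.

Lemma pmf_oscillation_ge0 X (h : int) : 0 <= h -> 0 <= pmf_oscillation X h.
Proof.
by move=> h0; apply: le_trans (@le_pmf_oscillation X h 0 0 _).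
Qed.

Lemma distr_fun_normalized X (a b x : R) : 0 < b ->
  distr_fun (distribution P (normalized X a b)) ((x - a) / b) =
  distr_fun (distribution P X) x.
Proof.
move=> b0; rewrite -!fine_prob_lt; congr (fine (P _)).
by apply/seteqP; split=> w /=; rewrite /normalized ltr_pM2r ?invr_gt0// ltrD2r.
Qed.

Lemma pmf_int_increment X (m : int) : (forall w, X w \is a Num.int) ->
  pmf X m%:~R = distr_fun (distribution P X) (m + 1)%:~R -
                distr_fun (distribution P X) m%:~R.
Proof.
move=> X_int; apply: EFin_inj; rewrite distr_funB ?ler_int ?lerDl//.
rewrite pmfE; congr (P _); apply/seteqP; split=> w /=; rewrite in_itv/=.
  by move=> ->; rewrite lexx ltr_int ltrDl.
have /intrP[k ->] := X_int w.
rewrite ler_int ltr_int ltzD1 => mk.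
by congr (_%:~R); apply/le_anti; rewrite andbC.
Qed.

Lemma sum_pmf_int X (m : int) (h : nat) : (forall w, X w \is a Num.int) ->
  \sum_(j < h) pmf X (m + j%:Z)%:~R =
  distr_fun (distribution P X) (m + h%:Z)%:~R - distr_fun (distribution P X) m%:~R.
Proof.
move=> X_int; elim: h => [|h IHh]; first by rewrite big_ord0 addr0 subrr.
have -> : m + h.+1%:Z = m + h%:Z + 1 by lia.
by rewrite big_ord_recr/= IHh pmf_int_increment// addrC subrKA.
Qed.

End kolmogorov.

(** * Point probabilities as averages over blocks *)

(** The three errors are those of replacing the point probability by its average
over the block of [h] integers from [m] on, the distribution function of the
normalized variable by that of [mu] at both ends of the block, and the density
on the block by its value at the left end. *)
Lemma block_average_bound (R : realType) (d : measure_display)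
    (T : measurableType d) (P : probability T R) (X : {RV P >-> R})
    (a b : R) (mu : probability R R) (g : R -> R)
    (eps omega c dl : R) (h : nat) :
  (forall w, X w \is a Num.int) -> 0 < b -> (0 < h)%N ->
  has_density mu g ->
  (forall x, `|distr_fun (distribution P (normalized X a b)) x -
               distr_fun mu x| <= eps) ->
  (forall m k : int, `|m - k| <= h%:Z ->
     `|pmf X m%:~R - pmf X k%:~R| <= omega) ->
  (forall x y, `|x - y| < dl -> `|g x - g y| < c) ->
  h%:R / b < dl ->
  forall m : int, `|pmf X m%:~R - b^-1 * g ((m%:~R - a) / b)| <=
    omega + 2 * (eps / h%:R) + c / b.
Proof.
move=> X_int b_gt0 h_gt0 g_mu F_G osc g_c h_dl m.
pose x := (m%:~R - a) / b; pose y := ((m + h%:Z)%:~R - a) / b.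
have hR_gt0 : 0 < h%:R :> R by rewrite ltr0n.
have hb_gt0 : 0 < h%:R / b by rewrite divr_gt0.
have yxE : y - x = h%:R / b by rewrite /y /x intrD -pmulrn; field; rewrite gt_eqF.
have yx_dl : y - x < dl by rewrite yxE.
have sumE : \sum_(j < h) pmf X (m + j%:Z)%:~R =
    distr_fun (distribution P (normalized X a b)) y -
    distr_fun (distribution P (normalized X a b)) x.
  by rewrite sum_pmf_int// !distr_fun_normalized.
have sum_osc : `|h%:R * pmf X m%:~R - \sum_(j < h) pmf X (m + j%:Z)%:~R|
    <= h%:R * omega.
  have -> : h%:R * pmf X m%:~R = \sum_(j < h) pmf X m%:~R.
    by rewrite sumr_const card_ord mulr_natl.
  rewrite -sumrB (le_trans (ler_norm_sum _ _ _))//.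
  have -> : h%:R * omega = \sum_(j < h) omega.
    by rewrite sumr_const card_ord mulr_natl.
  apply: ler_sum => j _; apply: osc; rewrite opprD addrA subrr add0r normrN.
  by rewrite ger0_norm// lez_nat ltnW.
have G_bnd : (g x - c) * (h%:R / b) <= distr_fun mu y - distr_fun mu x <=
    (g x + c) * (h%:R / b).
  rewrite -yxE; apply: (distr_fun_increment_bounds g_mu).
    by rewrite -subr_ge0 yxE ltW.
  move=> t /andP[xt ty].
  have /g_c : `|x - t| < dl by rewrite ltr_norml; apply/andP; split; lra.
  by rewrite ltr_norml => /andP[? ?]; apply/andP; split; lra.
have scaled : `|h%:R * (pmf X m%:~R - b^-1 * g x)| <=
    h%:R * (omega + 2 * (eps / h%:R) + c / b).
  have -> : h%:R * (omega + 2 * (eps / h%:R) + c / b) =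
      h%:R * omega + 2 * eps + c * (h%:R / b).
    by field; rewrite !gt_eqF.
  have -> : h%:R * (pmf X m%:~R - b^-1 * g x) =
      h%:R * pmf X m%:~R - g x * (h%:R / b) by field; rewrite gt_eqF.
  move: sum_osc G_bnd (F_G x) (F_G y); rewrite sumE mulrBl mulrDl !ler_norml.
  by move=> /andP[? ?] /andP[? ?] /andP[? ?] /andP[? ?]; apply/andP; split; lra.
by move: scaled; rewrite normrM gtr0_norm// ler_pM2l.
Qed.

(** * The block length *)

Section block_length.
Context {R : realType}.

Lemma sqrtr_le_sqr (x y : R) : 0 <= y -> x <= y ^+ 2 -> Num.sqrt x <= y.
Proof. by move=> y0 /ler_wsqrtr; rewrite sqrtr_sqr ger0_norm. Qed.

(** The lower bound needs the factor 2 because rounding down may lose almost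
half of a number just below 2. *)
Lemma block_length_bounds (e b : R) :
  let h := Num.max 1 (Num.floor (Num.sqrt e * b)) in
  0 <= b ->
  [/\ 1 <= h, (h%:~R : R) <= 1 \/ (h%:~R : R) <= Num.sqrt e * b &
      Num.sqrt e * b <= 2 * h%:~R].
Proof.
move=> h b_ge0; have h1 : 1 <= h by rewrite le_max lexx.
have /andP[floor_le lt_floor] := floor_itv (Num.sqrt e * b).
split=> //.
  by rewrite /h; case: (leP 1 (Num.floor _)) => _; [right|left].
have h1R : 1 <= h%:~R :> R by rewrite ler1z.
have : (Num.floor (Num.sqrt e * b))%:~R <= h%:~R :> R.
  by rewrite ler_int le_max lexx orbT.
by move: lt_floor; rewrite intrD; lra.
Qed.

Lemma block_length_near (eps b : nat -> R) :
  (forall e : R, 0 < e -> \forall n \near \oo, eps n <= e) ->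
  b n @[n --> \oo] --> +oo ->
  forall dl : R, 0 < dl -> \forall n \near \oo,
    (Num.max 1 (Num.floor (Num.sqrt (eps n) * b n)))%:~R / b n < dl.
Proof.
move=> eps_cvg b_cvg dl dl_gt0.
have sqrt_small : \forall n \near \oo, eps n <= (dl / 2) ^+ 2.
  by apply: eps_cvg; rewrite exprn_gt0 ?divr_gt0.
have /cvgryPgt/(_ dl^-1) b_large := b_cvg.
apply: filterS2 sqrt_small b_large => n eps_le b_ge.
have b_gt0 : 0 < b n by apply: lt_trans b_ge; rewrite invr_gt0.
have [_ h_le _] := block_length_bounds (eps n) (ltW b_gt0).
rewrite ltr_pdivrMr//.
case: h_le => /le_lt_trans; apply.
  by rewrite mulrC -ltr_pdivrMr// mul1r.
rewrite ltr_pM2r//; apply: le_lt_trans (_ : dl / 2 < _); last by lra.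
by apply: sqrtr_le_sqr => //; lra.
Qed.
End block_length.

(** * Equivalence of the local limit theorem and the oscillation condition *)

Theorem corollary1p3 (R : realType) (d : measure_display)
    (T : measurableType d) (P : probability T R)
    (S : nat -> {RV P >-> R}) (a b : nat -> R)
    (mu : probability R R) (G g : R -> R) (eps : nat -> R)
    (S_int : forall n, (1 <= n)%N -> forall w, S n w \is a Num.int)
    (b_gt0 : forall n, (1 <= n)%N -> 0 < b n)
    (b_cvg : b n @[n --> \oo] --> +oo)
    (S_cvg : converges_weakly
               (fun n => distribution P (normalized (S n) (a n) (b n))) mu)
    (G_mu : forall x, G x = distr_fun mu x)
    (g_mu : has_density mu g)
    (g_unif : unif_continuous g)
    (eps_def : forall n, (1 <= n)%N ->
       eps n = kolmogorov_dist P (normalized (S n) (a n) (b n)) G) :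
  uniform_littleo
    (fun (n : nat) (m : int) =>
       pmf (S n) m%:~R - (b n)^-1 * g ((m%:~R - a n) / b n))
    (fun n => (b n)^-1)
  <->
  (fun n => pmf_oscillation (S n)
              (Num.max 1 (Num.floor (Num.sqrt (eps n) * b n))))
    =o_\oo (fun n => (b n)^-1).
Proof.
have G_unif := distr_fun_unif_continuous g_mu g_unif.
have G01 x : 0 <= G x <= 1 by rewrite G_mu distr_fun_ge0 distr_fun_le1.
have F_G n x : (1 <= n)%N ->
    `|distr_fun (distribution P (normalized (S n) (a n) (b n))) x - distr_fun mu x|
      <= eps n.
  by move=> n1; rewrite eps_def// -G_mu; exact: le_kolmogorov_dist.
have eps_cvg (e : R) : 0 < e -> \forall n \near \oo, eps n <= e.
  move=> e_gt0.
  have F_cvg x := converges_weakly_distr_fun S_cvg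
    (@unif_continuous_continuous _ _ G_unif x).
  apply: filterS2 (polya_distr_fun_cvg F_cvg G_unif e_gt0) (nbhs_infty_ge 1) => n Fn n1.
  by rewrite eps_def//; apply: kolmogorov_dist_le => x; rewrite G_mu.
split=> [llt|/eqoP osc].
  apply/eqoP => e e_gt0.
  have e3_gt0 : 0 < e / 3 by rewrite divr_gt0.
  have [dl dl_gt0 g_dl] := (unif_continuousP g).1 g_unif _ e3_gt0.
  apply: filterS3 (llt _ e3_gt0) (block_length_near eps_cvg b_cvg dl_gt0)
    (nbhs_infty_ge 1) => n {}llt h_lt n1.
  have bn_gt0 := b_gt0 n n1; have bV_gt0 : 0 < (b n)^-1 by rewrite invr_gt0.
  have [h1 _ _] := block_length_bounds (eps n) (ltW bn_gt0).
  have h0 := le_trans ler01 h1.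
  rewrite /= ger0_norm ?pmf_oscillation_ge0//.
  apply: pmf_oscillation_le => // m k mk.
  move: (llt m) (llt k); rewrite (gtr0_norm bV_gt0).
  have /g_dl : `|(m%:~R - a n) / b n - (k%:~R - a n) / b n| < dl.
    apply: le_lt_trans h_lt.
    rewrite -mulrBl opprB addrA subrK normrM (gtr0_norm bV_gt0).
    by rewrite ler_pM2r// -intrB -intr_norm ler_int.
  rewrite -(ltr_pM2l bV_gt0) -(gtr0_norm bV_gt0) -normrM !(gtr0_norm bV_gt0) mulrBr.
  set u := (b n)^-1 * g _; set v := (b n)^-1 * g _.
  rewrite ltr_norml !ler_norml => /andP[? ?] /andP[? ?] /andP[? ?].
  by apply/andP; split; lra.
move=> e e_gt0; have e4_gt0 : 0 < e / 4 by rewrite divr_gt0.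
have [dl dl_gt0 g_dl] := (unif_continuousP g).1 g_unif _ e4_gt0.
(* Oscillation and density contribute [e / 4] each, and [2 * eps / h], which is
   at most [4 * sqrt eps / b], another [e / 4]. *)
have sqrt_small : \forall n \near \oo, eps n <= (e / 16) ^+ 2.
  by apply: eps_cvg; rewrite exprn_gt0 ?divr_gt0.
near=> n => m.
have n1 : (1 <= n)%N by near: n; exact: nbhs_infty_ge.
have bn_gt0 := b_gt0 n n1; have bV_gt0 : 0 < (b n)^-1 by rewrite invr_gt0.
set h := Num.max 1 (Num.floor (Num.sqrt (eps n) * b n)).
have [h1 _ h_ge] := block_length_bounds (eps n) (ltW bn_gt0).
have hE : h = `|h|%N by rewrite gez0_abs// (le_trans ler01 h1).
have hR : (`|h|%N)%:R = h%:~R :> R by rewrite [in RHS]hE.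
have h_gt0 : (0 < `|h|)%N by rewrite -ltz_nat -hE (lt_le_trans ltr01 h1).
have osc_n : pmf_oscillation (S n) h <= e / 4 * (b n)^-1.
  have : `|pmf_oscillation (S n) h| <= e / 4 * `|(b n)^-1|.
    by rewrite /h; near: n; exact: osc.
  by rewrite (gtr0_norm bV_gt0); apply: le_trans; exact: ler_norm.
have h_lt : (`|h|%N)%:R / b n < dl.
  by rewrite hR /h; near: n; exact: block_length_near.
have eps_ge0 : 0 <= eps n by apply: le_trans (F_G n 0 n1).
have sqrt_le : Num.sqrt (eps n) <= e / 16.
  by apply: sqrtr_le_sqr; [lra|near: n].
have osc_h (i j : int) : `|i - j| <= `|h|%N%:Z ->
    `|pmf (S n) i%:~R - pmf (S n) j%:~R| <= e / 4 * (b n)^-1.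
  by rewrite -hE => ij; apply: le_trans osc_n; exact: le_pmf_oscillation.
rewrite (gtr0_norm bV_gt0); apply: le_trans
  (block_average_bound (S_int n n1) bn_gt0 h_gt0 g_mu
    (fun x => F_G n x n1) osc_h g_dl h_lt m) _.
have eps_h : eps n / (`|h|%N)%:R <= 2 * (e / 16) / b n.
  rewrite ler_pdivrMr ?ltr0n// hR -[eps n]sqr_sqrtr// expr2.
  rewrite mulrAC ler_pdivlMr// -mulrA.
  have -> : 2 * (e / 16) * h%:~R = (e / 16) * (2 * h%:~R) by ring.
  by apply: ler_pM => //; rewrite ?sqrtr_ge0// mulr_ge0 ?sqrtr_ge0// ltW.
by have : 0 < e / b n := divr_gt0 e_gt0 bn_gt0; lra.
Unshelve. all: by end_near. Qed.
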